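(* A uniform passport of genus $1$ (with $n$ edges) admits a non-regular dessin if and only if none of its three entries is the partition $n^{1}$. In other words, for a positive integer $m$, the genus-$1$ uniform passports $[2^{2m},4^{m},4^{m}]$, $[3^{m},3^{m},3^{m}]$, $[3^{2m},2^{3m},6^{m}]$, and those obtained by permuting their entries, admit a non-regular dessin if and only if $m\ge 2$.
   Context: A dessin d'enfant (dessin) is a connected, finite, bipartite graph (vertices colored black and white, each edge joining a black vertex to a white vertex) embedded as a map in a connected, compact, oriented surface without boundary, so that every face is homeomorphic to a disk. Let $E$ be its set of edges and $n=|E|$. Let $x$ (resp. $y$) be the permutation of $E$ sending each edge $e$ to the next edge counterclockwise around the unique black (resp. white) vertex incident to $e$. The monodromy group is $G=\langle x,y\rangle\le \mathrm{Sym}(E)$; it acts transitively on $E$. Permutations act on the left and are composed from right to left. The cycles of $x$, $y$ and $(xy)^{-1}$ correspond to the black vertices, white vertices and faces, and the cycle lengths are their valencies. Conversely, any pair of permutations $x,y$ of an $n$-element set generating a transitive group arises in this way from a dessin. The passport of a dessin with $n$ edges is the triple $[\lambda_0,\lambda_1,\lambda_\infty]$ of partitions of $n$ given by the valencies of black vertices, white vertices and faces (equivalently the cycle types of $x$, $y$, $(xy)^{-1}$). Its genus is $g=\frac{n-(l(\lambda_0)+l(\lambda_1)+l(\lambda_\infty))}{2}+1$, where $l(\lambda)$ is the number of parts of $\lambda$. The notation $a^{p}$ denotes the partition with $p$ parts all equal to $a$. A passport is uniform if it has the form $[a^{p},b^{q},c^{r}]$ with $n=pa=qb=rc$. A passport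 admits a dessin with some property if there is a dessin with that passport and that property. A dessin is regular if its monodromy group acts freely (hence regularly) on $E$; otherwise it is non-regular. *)

(* Defs.v *)
From HB Require Import structures.
From mathcomp Require Import all_boot all_order all_algebra all_fingroup.

Set Implicit Arguments.
Unset Strict Implicit.
Unset Printing Implicit Defensive.

(* A dessin is encoded by its finite set of edges together with the rotations
   around black and white vertices.  Transitivity expresses connectedness; in
   MathComp it also forces the set of edges to be nonempty. *)
Record dessin := Dessin {
  edge : finType;
  black_perm : {perm edge};
  white_perm : {perm edge};
  dessin_transitive :
    [transitive <<[set black_perm; white_perm]>>%g, on [set: edge] | 'P] }.

Definition monodromy (D : dessin) : {group {perm edge D}} :=
  <<[set black_perm D; white_perm D]>>%G.

(* This is (xy)^-1 for permutations composed from right to left: MathComp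
   composes from left to right, (s * t) e = t (s e). *)
Definition face_perm (D : dessin) : {perm edge D} :=
  ((white_perm D * black_perm D)^-1)%g.

Definition acts_freely (T : finType) (G : {group {perm T}}) : Prop :=
  forall (g : {perm T}) (e : T), g \in G -> g e = e -> g = 1%g.

Definition regular (D : dessin) : Prop := acts_freely (monodromy D).

(* Partitions are nonincreasing sequences of positive integers, so the
   partition a^p is [nseq p a] and n^1 is [:: n]. *)
Definition int_partition (n : nat) (l : seq nat) : bool :=
  [&& sorted geq l, 0 \notin l & sumn l == n].

(* Fixed points count as cycles of length 1. *)
Definition cycle_type (T : finType) (s : {perm T}) : seq nat :=
  sort geq [seq #|C| | C : {set T} <- enum (porbits s)].

Record passport := Passport {
  lambda0 : seq nat;
  lambda1 : seq nat;
  lambdaoo : seq nat }.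

Definition entries (P : passport) : seq (seq nat) :=
  [:: lambda0 P; lambda1 P; lambdaoo P].

Definition is_passport (n : nat) (P : passport) : bool :=
  (0 < n) && all (int_partition n) (entries P).

Definition passport_of (D : dessin) : passport :=
  Passport (cycle_type (black_perm D)) (cycle_type (white_perm D))
           (cycle_type (face_perm D)).

Definition genus (n : nat) (P : passport) : rat :=
  ((n%:R - (size (lambda0 P) + size (lambda1 P) + size (lambdaoo P))%:R) / 2%:R
   + 1)%R.

Definition uniform (n : nat) (P : passport) : Prop :=
  exists a b c p q r : nat,
    P = Passport (nseq p a) (nseq q b) (nseq r c) /\
    [/\ n = p * a, n = q * b & n = r * c].

Definition admits (P : passport) (property : dessin -> Prop) : Prop :=
  exists D : dessin, passport_of D = P /\ property D.

Definition same_up_to_permutation (P Q : passport) : bool :=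
  perm_eq (entries P) (entries Q).

Definition in_genus1_families (m : nat) (P : passport) : bool :=
  [|| same_up_to_permutation P
        (Passport (nseq (2 * m) 2) (nseq m 4) (nseq m 4)),
      same_up_to_permutation P
        (Passport (nseq m 3) (nseq m 3) (nseq m 3))
    | same_up_to_permutation P
        (Passport (nseq (2 * m) 3) (nseq (3 * m) 2) (nseq m 6))].

(* Main.v *)
Require Import Defs.
From HB Require Import structures.
From mathcomp Require Import all_boot all_order all_algebra all_fingroup.
From mathcomp Require Import zify ring lra.

(* A uniform passport of genus 1 amounts to 1/a + 1/b + 1/c = 1, hence to a map
   of type (4,4,2), (3,3,3) or (6,3,2) on a torus C / L, with L a sublattice of
   index m of the Gaussian or Eisenstein integers.  The dessin is regular when
   the rotation of order k = 4, 3 or 6 preserves L.  For m >= 2 this fails for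
   the sublattice L of the points whose second coordinate (along the rotated
   unit vector) is a multiple of m.  The edges are then pairs (v, d) in
   Z/m x Z/k, where v is a lattice point modulo L and d a direction: black
   vertices rotate d, and white vertices add to v the second coordinate f d of
   the d-th unit vector before rotating d.  For m = 1 some permutation is a full
   cycle, which may be taken to be the black one; the other cycle lengths force
   the white permutation to be a power of it, so that the monodromy group is
   abelian. *)

Set Implicit Arguments.
Unset Strict Implicit.
Unset Printing Implicit Defensive.

Import GroupScope.

(** * Permutations all of whose cycles have the same length *)

Section CycleType.

Variables (T : finType) (s : {perm T}).

Lemma partition_porbits : partition (porbits s) [set: T].
Proof.
have -> : porbits s = [set orbit 'P <[s]> x | x in [set: T]].
  by apply/setP=> A; apply/imsetP/imsetP=> -[x _ ->]; exists x;
    rewrite ?inE ?porbit.unlock.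
by apply: orbit_partition; apply/actsP=> g _ x; rewrite !inE.
Qed.

(** The cycles partition [T], so their common length and [#|T|] already determine how many there
    are. *)
Lemma cycle_type_nseqP (p a : nat) : 0 < a ->
  cycle_type s = nseq p a <->
  (forall u, #|porbit s u| = a) /\ #|T| = (p * a)%N.
Proof.
move=> a_gt0; set sizes := [seq #|C| | C : {set T} <- enum (porbits s)].
have size_sizes : size sizes = #|porbits s| by rewrite size_map -cardE.
have cardT (H : forall u, #|porbit s u| = a) : #|T| = (#|porbits s| * a)%N.
  rewrite -cardsT; apply: card_uniform_partition partition_porbits.
  by move=> _ /imsetP[u _ ->].
have allP : reflect (forall u, #|porbit s u| = a) (all (pred1 a) (sort geq sizes)).
  rewrite all_sort; apply: (iffP allP) => [H u | H _ /mapP[C + ->] /=].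
    by apply/eqP/H/map_f; rewrite mem_enum imset_f.
  by rewrite mem_enum => /imsetP[u _ ->]; rewrite H.
split=> [E | [H cT]].
  have H : forall u, #|porbit s u| = a.
    by apply/allP; rewrite -/(cycle_type s) E all_pred1_nseq.
  split=> //; rewrite (cardT H) -size_sizes -(size_sort geq).
  by rewrite -/(cycle_type s) E size_nseq.
have/allP/all_pred1P := H; rewrite -/(cycle_type s) => ->.
congr nseq; rewrite size_sort size_sizes.
by move: cT; rewrite (cardT H) => /eqP; rewrite eqn_pmul2r // => /eqP.
Qed.

Lemma card_porbit_iter (a : nat) (u : T) : 0 < a ->
  iter a s u = u -> (forall j, 0 < j < a -> iter j s u != u) ->
  #|porbit s u| = a.
Proof.
move=> a_gt0 ua nfix; set c := #|porbit s u|.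
have c_gt0 : 0 < c by rewrite lt0n card_porbit_neq0.
case: (ltngtP c a) => // [ltca | ltac].
  by have := nfix c; rewrite c_gt0 ltca iter_porbit eqxx => /(_ isT).
(* If [a < c], entries [0] and [a] of the duplicate-free list of the first [c] iterates coincide,
   which forces [a = 0]. *)
have := uniq_traject_porbit s u; rewrite -/c => /(nth_uniq u).
rewrite size_traject => /(_ 0%N a c_gt0 ltac).
by rewrite !nth_traject //= ua eqxx => /esym/eqP a0; rewrite -a0 in a_gt0.
Qed.

Lemma cycle_type_iter (p a : nat) : cycle_type s = nseq p a -> 0 < a ->
  forall u, iter a s u = u.
Proof.
move=> E a0 u; have [/(_ u) <- _] := (cycle_type_nseqP p a0).1 E.
exact: iter_porbit.
Qed.

Lemma cycle_type_no_fix (p a : nat) : cycle_type s = nseq p a -> 1 < a ->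
  forall u, s u <> u.
Proof.
move=> E a1 u su; have [/(_ u) + _] := (cycle_type_nseqP p (ltnW a1)).1 E.
rewrite (@card_porbit_iter 1) // => [a1E | [|] //].
by rewrite -a1E in a1.
Qed.

Lemma cycle_type_single (n : nat) : cycle_type s = [:: n] -> 0 < n ->
  forall u v, exists2 k, k < n & v = iter k s u.
Proof.
move=> E n0 u v; have [/(_ u) cu cT] := (cycle_type_nseqP 1 n0).1 E.
have: v \in porbit s u.
  suff -> : porbit s u = [set: T] by rewrite inE.
  by apply/eqP; rewrite eqEcard subsetT cardsT cT cu mul1n leqnn.
by rewrite porbit_traject cu => /trajectP.
Qed.

Lemma cycle_typeV : cycle_type s^-1 = cycle_type s.
Proof. by rewrite /cycle_type porbitsV. Qed.

End CycleType.

(** * Regularity, change of generators and permutation of the passport entries *)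

(** A transitive abelian group acts freely: an element fixing [e] also fixes every translate of
    [e]. *)
Lemma regular_commuting (D : dessin) :
  commute (black_perm D) (white_perm D) -> regular D.
Proof.
move=> cxy g e Gg ge; apply/permP=> v; rewrite perm1.
have abG : abelian (monodromy D).
  rewrite abelian_gen; apply/centsP=> a + b.
  by rewrite !inE => /orP[]/eqP-> /orP[]/eqP->; rewrite /commute ?cxy.
have /imsetP[e0 _ orb] := dessin_transitive D.
have /orbitP[h Gh he] : e \in orbit 'P (monodromy D) e0 by rewrite -orb inE.
have /orbitP[k Gk kv] : v \in orbit 'P (monodromy D) e0 by rewrite -orb inE.
rewrite /= /aperm in he kv.
have -> : v = (h^-1 * k) e by rewrite permM -he permK kv.
by rewrite -permM -(centsP abG g Gg) ?groupM ?groupV // permM ge.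
Qed.

(** Regularity depends only on the monodromy group, so another generating pair may change the
    passport but not the regularity. *)
Lemma dessin_change_generators (D : dessin) (a b : {perm edge D}) :
  <<[set a; b]>> = <<[set black_perm D; white_perm D]>> ->
  exists D', passport_of D' = Passport (cycle_type a) (cycle_type b)
                                (cycle_type (b * a)^-1)
    /\ (regular D' -> regular D).
Proof.
move=> E; have tr := dessin_transitive D; rewrite -E in tr.
exists (Dessin tr); split=> // R g e; rewrite /monodromy /= -E.
exact: (R g e).
Qed.

Lemma gen_set2_sub (gT : finGroupType) (S : {set gT}) u v :
  u \in <<S>> -> v \in <<S>> -> <<[set u; v]>> \subset <<S>>.
Proof. by move=> Su Sv; rewrite gen_subG subUset !sub1set Su. Qed.

Definition non_regular (D : dessin) := ~ regular D.

(** The pair [y], [(y * x)^-1] generates the same group, and its face permutation is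
    [y^-1 * (y * x) = x]. *)
Lemma admits_rotate a b c :
  admits (Passport a b c) non_regular -> admits (Passport b c a) non_regular.
Proof.
case=> D [[<- <- <-] nr]; set x := black_perm D; set y := white_perm D.
have [|D' [E R]] := @dessin_change_generators D y (face_perm D).
  apply/eqP; rewrite eqEsubset /face_perm -/x -/y.
  have hy : y \in <<[set y; (y * x)^-1]>> by rewrite mem_gen // !inE eqxx.
  have : (y * x)^-1 \in <<[set y; (y * x)^-1]>>.
    by rewrite mem_gen // !inE eqxx orbT.
  rewrite groupV => /(groupM (groupVr hy)); rewrite mulKg => hx.
  by rewrite !gen_set2_sub // ?groupV ?groupM // mem_gen // !inE eqxx ?orbT.
exists D'; split; last by move/R.
rewrite E; congr Passport.
by rewrite /face_perm invMg invgK mulKg.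
Qed.

(* The mirror image with the two colours exchanged. *)
Lemma admits_swap a b c :
  admits (Passport a b c) non_regular -> admits (Passport b a c) non_regular.
Proof.
case=> D [[<- <- <-] nr]; set x := black_perm D; set y := white_perm D.
have [|D' [E R]] := @dessin_change_generators D y^-1 x^-1.
  apply/eqP; rewrite eqEsubset -/x -/y.
  rewrite gen_set2_sub ?groupV ?mem_gen ?inE ?eqxx ?orbT //=.
  by rewrite gen_set2_sub // -groupV mem_gen // !inE eqxx ?orbT.
exists D'; split; last by move/R.
rewrite E !cycle_typeV; congr Passport.
by rewrite /face_perm -invMg cycle_typeV.
Qed.

(** A rotation and a transposition generate all permutations of the three entries. *)
Lemma same_up_to_permutation_ind (Q : passport -> Prop) :
  (forall a b c, Q (Passport a b c) -> Q (Passport b c a)) ->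
  (forall a b c, Q (Passport a b c) -> Q (Passport b a c)) ->
  forall P P', same_up_to_permutation P P' -> Q P' -> Q P.
Proof.
move=> rot swap [a b c] [a' b' c'] /=; rewrite /same_up_to_permutation /entries /=.
(* Once the first entries agree, the other two agree or are exchanged; a swap followed by a rotation
   exchanges them. *)
have same_head b1 c1 : perm_eq [:: a; b; c] [:: a; b1; c1] ->
    Q (Passport a b1 c1) -> Q (Passport a b c).
  rewrite perm_cons => E; have := perm_mem E b; rewrite !inE eqxx => /esym/orP[]/eqP bE.
    by move: E; rewrite bE perm_cons => /perm_consP[[|i] [[|u v] [//= [->]]]].
  rewrite bE in E *; move: E; rewrite (perm_sym _ [:: b1; c1]).
  rewrite -[[:: b1; c1]]/([:: b1] ++ [:: c1]) perm_catC /= perm_cons.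
  by move=> /perm_consP[[|i] [[|u v] [//= [->]]]] _ /swap/rot.
move=> E; have := perm_mem E a; rewrite !inE eqxx => /esym/or3P[]/eqP aE.
- by subst a'; apply: same_head.
- subst b' => /rot; apply: same_head; apply: perm_trans E _.
  by rewrite -[[:: a'; a; c']]/([:: a'] ++ [:: a; c']) perm_catC.
- subst c' => /rot/rot; apply: same_head; apply: perm_trans E _.
  by rewrite -[[:: a'; b'; a]]/([:: a'; b'] ++ [:: a]) perm_catC.
Qed.

Lemma same_up_to_permutation_sym P P' :
  same_up_to_permutation P P' = same_up_to_permutation P' P.
Proof. exact: perm_sym. Qed.

Lemma admits_same_up_to_permutation P P' : same_up_to_permutation P P' ->
  admits P non_regular <-> admits P' non_regular.
Proof.
move=> E; split; apply: (same_up_to_permutation_ind (Q := admits^~ non_regular));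
  by [exact: admits_rotate | exact: admits_swap | rewrite // same_up_to_permutation_sym].
Qed.

(** * The case [m = 1]: a single black vertex forces regularity *)

Section OneVertex.

Variable D : dessin.
Let x := black_perm D.
Let y := white_perm D.

(** A fixed edge of [y * x] would give a face of valency 1. When [y u] is written as [x^j u], this
    excludes [j = 0] and [j = -1]. *)
Lemma white_perm_not_back p q b c :
  cycle_type y = nseq p b -> 1 < b ->
  cycle_type (face_perm D) = nseq q c -> 1 < c ->
  forall u, y u <> u /\ x (y u) <> u.
Proof.
move=> ty b1 tf c1 u; split; first exact: cycle_type_no_fix ty b1 u.
rewrite -permM => fu; apply: (cycle_type_no_fix (s := y * x) (p := q)) c1 _ fu.
by rewrite -cycle_typeV.
Qed.

Lemma regular_3_3_3 : passport_of D = Passport [:: 3] [:: 3] [:: 3] -> regular D.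
Proof.
case=> tx ty tf; apply: regular_commuting; rewrite -/x -/y.
have nb := white_perm_not_back (p := 1) (q := 1) ty isT tf isT.
have x3 u : x (x (x u)) = u := cycle_type_iter (p := 1) tx isT u.
suff -> : y = x by [].
apply/permP=> u; have [yu xyu] := nb u.
have [[|[|[|k]]] // _ E] := cycle_type_single tx isT u (y u) => //.
by case: xyu; rewrite E /= x3.
Qed.

Lemma regular_4_22_4 : passport_of D = Passport [:: 4] [:: 2; 2] [:: 4] -> regular D.
Proof.
case=> tx ty tf; apply: regular_commuting; rewrite -/x -/y.
have nb := white_perm_not_back (p := 2) (q := 1) ty isT tf isT.
have y2 u : y (y u) = u := cycle_type_iter (p := 2) ty isT u.
have x4 u : x (x (x (x u))) = u := cycle_type_iter (p := 1) tx isT u.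
have yE u : y u = x (x u).
  have [yu xyu] := nb u; have [_ xu] := nb (y u).
  have [[|[|[|[|k]]]] // _ E] := cycle_type_single tx isT u (y u) => //.
  - by case: xu; rewrite y2 E.
  - by case: xyu; rewrite E /= x4.
by apply/permP=> u; rewrite !permM !yE.
Qed.

(** Among the exponents [j] with [y u = x^j u], only 3 survives: 0, 1 and 5 would give a fixed edge
    of [y] or of [y * x], 2 contradicts the faces of length three, and 4 reduces to 2. *)
Lemma regular_6_222_33 :
  passport_of D = Passport [:: 6] [:: 2; 2; 2] [:: 3; 3] -> regular D.
Proof.
case=> tx ty tf; apply: regular_commuting; rewrite -/x -/y.
have nb := white_perm_not_back (p := 3) (q := 2) ty isT tf isT.
have y2 u : y (y u) = u := cycle_type_iter (p := 3) ty isT u.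
have x6 u : iter 6 x u = u := cycle_type_iter (p := 1) tx isT u.
have f3 u : x (y (x (y (x (y u))))) = u.
  have ct : cycle_type (y * x) = nseq 2 3 by rewrite -cycle_typeV.
  by have := cycle_type_iter ct isT u; rewrite /= !permM.
have nx0 u : x u <> u := cycle_type_no_fix (p := 1) tx isT (u := u).
have nx u : x u <> y u.
  by have [_ +] := nb (y u); rewrite y2.
have nx5 u : y u <> iter 5 x u.
  by move=> E; have [_ []] := nb u; rewrite E -[RHS]x6.
(* If [y u = x^2 u], then the edge [x^3 u] lies in a face of length three with
   [u], and every possible value of [y (x^3 u)] is excluded. *)
have nx2 u : y u <> iter 2 x u.
  move=> E; have := f3 u; rewrite E /=; set v := x (x (x u)) => F.
  have xv : x (x (x v)) = u := x6 u.
  have [[|[|[|[|[|[|k]]]]]] // _ G] := cycle_type_single tx isT v (y v).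
  - by have [[]] := nb v.
  - by case: (nx v).
  - by have [_ []] := nb u; rewrite -[RHS]F G /= xv.
  - by have := nx0 (y u); rewrite E /= -/v -[v]y2 G /= xv.
  - by have := nx0 u; rewrite -[X in _ <> X]F G /= xv -[x (x u)]E y2.
  - by case: (nx5 v).
have yE u : y u = iter 3 x u.
  have [yu xyu] := nb u.
  have [[|[|[|[|[|[|k]]]]]] // _ E] := cycle_type_single tx isT u (y u) => //.
  - by case: (nx u).
  - by case: (nx2 u).
  (* Exponent 4 at [u] is exponent 2 at [y u], because [y] is an involution and [x^6 = 1]. *)
  - case: (nx2 (iter 4 x u)); by rewrite -E y2 E -[LHS]x6.
  - by case: (nx5 u).
by apply/permP=> u; rewrite !permM !yE.
Qed.

End OneVertex.

(** * Non-regular dessins on [Z/m x Z/k] *)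

Section SkewDessin.

Import GRing.Theory.

(* ['Z_m] is [Z/m] because [1 < m]. *)
Variables (m k : nat).
Hypotheses (m_gt1 : 1 < m) (k_gt1 : 1 < k).

Section SkewPerm.

Variables (f : 'Z_k -> 'Z_m) (c : 'Z_k).

Local Open Scope ring_scope.

(** A skew product over the rotation by [c]. Black ([f = 0], [c = 1]), white and inverse face
    permutations all have this form, so one cycle count serves the three entries. *)
Definition skew_shift (u : 'Z_m * 'Z_k) := (u.1 + f u.2, u.2 + c).

Lemma skew_shift_inj : injective skew_shift.
Proof.
move=> [v d] [v' d'] E; have /addIr /= dE := congr1 snd E.
by have /= := congr1 fst E; rewrite dE => /addIr->.
Qed.

Definition skew_perm : {perm 'Z_m * 'Z_k} := perm skew_shift_inj.

Lemma skew_permE v d : skew_perm (v, d) = (v + f d, d + c).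
Proof. by rewrite permE. Qed.

Lemma iter_skew_perm j v d :
  iter j skew_perm (v, d) = (v + \sum_(i < j) f (d + c *+ i), d + c *+ j).
Proof.
elim: j => [|j IH] /=; first by rewrite big_ord0 !addr0.
by rewrite IH skew_permE big_ord_recr /= addrA mulrSr addrA.
Qed.

(** The sum of [f] is the total translation after [a] steps; its vanishing closes the cycle, while
    the direction alone prevents an earlier return. *)
Lemma cycle_type_skew_perm a p : (0 < a)%N -> (m * k = p * a)%N ->
  c *+ a = 0 -> (forall j, (0 < j < a)%N -> c *+ j != 0) ->
  (forall d, \sum_(i < a) f (d + c *+ i) = 0) ->
  cycle_type skew_perm = nseq p a.
Proof.
move=> a0 mk ca cj fa; apply/cycle_type_nseqP => //; split.
  move=> [v d]; apply: card_porbit_iter => // [|j /cj cj0].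
    by rewrite iter_skew_perm fa ca !addr0.
  rewrite iter_skew_perm; apply: contraNneq cj0 => /(congr1 snd)/= /eqP.
  by rewrite -subr_eq0 addrAC subrr add0r.
by rewrite card_prod !card_ord !Zp_cast.
Qed.

End SkewPerm.

Variables (f : 'Z_k -> 'Z_m) (c : 'Z_k).
Hypotheses (f0 : f 0%R = 0%R) (f1 : f 1%R = 1%R).

Let x := skew_perm (fun=> 0%R) 1%R.
Let y := skew_perm f c.

(** Powers of [x] reach every direction over a fixed [v], and [y] applied in direction 1 leads from
    [v] to [v + 1] since [f 1 = 1]. *)
Lemma skew_transitive : [transitive <<[set x; y]>>, on [set: 'Z_m * 'Z_k] | 'P].
Proof.
pose G := <<[set x; y]>>%G; pose O := orbit 'P G (0%R, 0%R).
have stable g u : g \in G -> u \in O -> g u \in O.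
  move=> Gg /orbitP[h Gh <-]; apply/orbitP; exists (h * g); rewrite ?groupM //.
  by rewrite /= /aperm permM.
have Gx : x \in G by rewrite mem_gen // !inE eqxx.
have Gy : y \in G by rewrite mem_gen // !inE eqxx orbT.
have row v d : (v, d) \in O -> forall d', (v, d') \in O.
  move=> Ovd d'; have /(_ (d' - d : 'Z_k)%R) : forall j : nat, iter j x (v, d) \in O.
    by elim=> //= j; apply: stable.
  rewrite iter_skew_perm big1 // addr0 -[(1 *+ _)%R]/((d' - d)%R%:R)%R natr_Zp.
  by rewrite addrC subrK.
have Onat n d : ((n%:R)%R, d) \in O.
  elim: n d => [|n IH]; first by apply: (row _ 0%R); exact: orbit_refl.
  apply: (row _ (1 + c)%R); have := stable _ _ Gy (IH 1%R).
  by rewrite skew_permE f1 -mulrSr.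
apply/imsetP; exists (0%R, 0%R); rewrite ?inE //; apply/esym/setP=> -[v d].
by rewrite inE -[v]natr_Zp Onat.
Qed.

Definition skew_dessin := Dessin skew_transitive.

(* The translation [y * x ^+ j] with [j = - c] fixes the fibre over [0] but not
   the one over [1]. *)
Lemma skew_dessin_non_regular : non_regular skew_dessin.
Proof.
move=> R; pose g := y * x ^+ (- c : 'Z_k)%R.
have gE v d : g (v, d) = (v + f d, d)%R.
  rewrite permM permX skew_permE iter_skew_perm big1 // addr0.
  by rewrite natr_Zp addrK.
have Gg : g \in monodromy skew_dessin.
  by rewrite groupM ?groupX // mem_gen // !inE eqxx ?orbT.
have := R g (0%R, 0%R) Gg; rewrite gE f0 addr0 => /(_ erefl) g1.
have := gE 0%R 1%R; rewrite g1 perm1 f1 add0r => /(congr1 fst)/= /eqP.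
by rewrite eq_sym oner_eq0.
Qed.

Lemma face_perm_skew_dessin :
  face_perm skew_dessin = (skew_perm f (c + 1)%R)^-1.
Proof.
congr (_^-1); apply/permP=> -[v d].
by rewrite permM !skew_permE addr0 addrA.
Qed.

(** The hypotheses make [b] and [a] the orders of [c] and [c + 1] in [Z/k], and make [f] sum to zero
    over the cosets they generate, so that white and face cycles close up. *)
Lemma skew_dessin_admits p q b r a : 0 < b -> 0 < a ->
  p = m -> (m * k = q * b)%N -> (m * k = r * a)%N ->
  (c *+ b = 0)%R -> (forall j, 0 < j < b -> (c *+ j != 0)%R) ->
  (forall d, \sum_(i < b) f (d + c *+ i) = 0)%R ->
  ((c + 1) *+ a = 0)%R -> (forall j, 0 < j < a -> ((c + 1) *+ j != 0)%R) ->
  (forall d, \sum_(i < a) f (d + (c + 1) *+ i) = 0)%R ->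
  admits (Passport (nseq p k) (nseq q b) (nseq r a)) non_regular.
Proof.
move=> b0 a0 -> qb ra cb cj fb ca caj fa; exists skew_dessin; split; last first.
  exact: skew_dessin_non_regular.
rewrite /passport_of face_perm_skew_dessin cycle_typeV.
congr Passport; apply: cycle_type_skew_perm => //; first exact: ltnW.
- exact: pchar_Zp.
- move=> j /andP[j0 jk]; apply/eqP=> /(congr1 val).
  by rewrite /= val_Zp_nat // modn_small // => j0E; rewrite j0E in j0.
- by move=> d; rewrite big1.
Qed.

End SkewDessin.

Lemma admits_3_3_3 m : 1 < m ->
  admits (Passport (nseq m 3) (nseq m 3) (nseq m 3)) non_regular.
Proof.
(* Second coordinates of 1, w, w^2 = -1 - w in the basis 1, w, for w a primitive cube root of
   unity. *)
move=> m1; pose f (d : 'Z_3) : 'Z_m := ([:: 0; 1; -1]`_d)%R.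
apply: (@skew_dessin_admits m 3 m1 isT f 1%R) => //.
- by apply/eqP.
- by case=> [|[|[|j]]] //.
- case=> [[|[|[|d]]] d3] //; rewrite !big_ord_recr big_ord0 /f /=; ring.
- by apply/eqP.
- by case=> [|[|[|j]]] //.
- case=> [[|[|[|d]]] d3] //; rewrite !big_ord_recr big_ord0 /f /=; ring.
Qed.

Lemma admits_4_2_4 m : 1 < m ->
  admits (Passport (nseq m 4) (nseq (2 * m) 2) (nseq m 4)) non_regular.
Proof.
(* Second coordinates of 1, i, -1, -i. The shift [c = 2] is a half-turn, as white vertices have
   valency 2. *)
move=> m1; pose f (d : 'Z_4) : 'Z_m := ([:: 0; 1; 0; -1]`_d)%R.
apply: (@skew_dessin_admits m 4 m1 isT f 2%:R%R) => //.
- lia.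
- by apply/eqP.
- by case=> [|[|[|j]]] //.
- case=> [[|[|[|[|d]]]] d3] //; rewrite !big_ord_recr big_ord0 /f /=; ring.
- by apply/eqP.
- by case=> [|[|[|[|j]]]] //.
- case=> [[|[|[|[|d]]]] d3] //; rewrite !big_ord_recr big_ord0 /f /=; ring.
Qed.

Lemma admits_6_2_3 m : 1 < m ->
  admits (Passport (nseq m 6) (nseq (3 * m) 2) (nseq (2 * m) 3)) non_regular.
Proof.
(* Second coordinates of the powers of a primitive sixth root of unity z in the basis 1, z, where
   z^2 = z - 1. Again [c = 3] is a half-turn. *)
move=> m1; pose f (d : 'Z_6) : 'Z_m := ([:: 0; 1; 1; 0; -1; -1]`_d)%R.
apply: (@skew_dessin_admits m 6 m1 isT f 3%:R%R) => //.
- lia.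
- lia.
- by apply/eqP.
- by case=> [|[|[|j]]] //.
- case=> [[|[|[|[|[|[|d]]]]]] d3] //; rewrite !big_ord_recr big_ord0 /f /=; ring.
- by apply/eqP.
- by case=> [|[|[|[|j]]]] //.
- case=> [[|[|[|[|[|[|d]]]]]] d3] //; rewrite !big_ord_recr big_ord0 /f /=; ring.
Qed.

(** * Classification of the uniform passports of genus 1 *)

Definition genus1_uniform (n : nat) (P : passport) : Prop :=
  [/\ is_passport n P, uniform n P & genus n P = 1%R].

Lemma genus1_uniformP n P : genus1_uniform n P <->
  0 < n /\ exists a b c p q r : nat,
    P = Passport (nseq p a) (nseq q b) (nseq r c) /\
    [/\ n = p * a, n = q * b, n = r * c & n = p + q + r]%N.
Proof.
have genusE a b c p q r :
    genus n (Passport (nseq p a) (nseq q b) (nseq r c)) = 1%R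
    <-> n = (p + q + r)%N.
  rewrite /genus /= !size_nseq; split=> [E | ->]; last by lra.
  by apply/eqP; rewrite -(Num.Theory.eqr_nat rat); apply/eqP; lra.
split=> [[/andP[n0 _] [a [b [c [p [q [r [-> [pa qb rc]]]]]]]] /genusE npqr]|].
  by split=> //; exists a, b, c, p, q, r.
case=> n0 [a [b [c [p [q [r [-> [pa qb rc /genusE G]]]]]]]]; split=> //; last first.
  by exists a, b, c, p, q, r.
have part k d : n = (k * d)%N -> int_partition n (nseq k d).
  move=> nE; have d0 : 0 < d by case: d nE => // nE; rewrite nE muln0 in n0.
  rewrite /int_partition sumn_nseq mulnC -nE eqxx andbT mem_nseq eq_sym.
  rewrite negb_and (gtn_eqF d0) orbT andbT.
  by case: {nE} k => //= k; elim: k => //= k ->; rewrite leqnn.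
by rewrite /is_passport n0 /= !part.
Qed.

Lemma genus1_uniform_same n P P' : same_up_to_permutation P P' ->
  genus1_uniform n P' -> genus1_uniform n P.
Proof.
apply: (same_up_to_permutation_ind (Q := genus1_uniform n)).
- move=> A B C /genus1_uniformP[n0 [a [b [c [p [q [r [[-> -> ->] [? ? ? npqr]]]]]]]]].
  apply/genus1_uniformP; split=> //; exists b, c, a, q, r, p; do 2!split=> //.
  lia.
- move=> A B C /genus1_uniformP[n0 [a [b [c [p [q [r [[-> -> ->] [? ? ? npqr]]]]]]]]].
  apply/genus1_uniformP; split=> //; exists b, a, c, q, p, r; do 2!split=> //.
  lia.
Qed.

(** The black entry comes first with [m] parts of the largest valency: this is the order produced by
    [skew_dessin_admits], and it makes [x] a full cycle when [m = 1]. *)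
Inductive genus1_standard (m : nat) : passport -> Prop :=
| Standard4 : genus1_standard m (Passport (nseq m 4) (nseq (2 * m) 2) (nseq m 4))
| Standard3 : genus1_standard m (Passport (nseq m 3) (nseq m 3) (nseq m 3))
| Standard6 : genus1_standard m
    (Passport (nseq m 6) (nseq (3 * m) 2) (nseq (2 * m) 3)).

Lemma in_genus1_familiesP m P : in_genus1_families m P <->
  exists2 P', genus1_standard m P' & same_up_to_permutation P P'.
Proof.
have swap (a b c : seq nat) : perm_eq [:: a; b; c] [:: b; a; c].
  by rewrite -[[:: a; b; c]]/([:: a] ++ [:: b] ++ [:: c]) perm_catCA.
have flip (a b c : seq nat) : perm_eq [:: a; b; c] [:: c; b; a].
  by rewrite -[[:: a; b; c]]/(rev [:: c; b; a]) perm_rev.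
rewrite /in_genus1_families /same_up_to_permutation /entries /=.
rewrite (permPr (swap (nseq (2 * m) 2) _ _)) (permPr (flip (nseq (2 * m) 3) _ _)).
split=> [/or3P[] E | [_ [] /= E]]; last 3 first; rewrite ?E ?orbT //.
- by exists (Passport (nseq m 4) (nseq (2 * m) 2) (nseq m 4)); first constructor.
- by exists (Passport (nseq m 3) (nseq m 3) (nseq m 3)); first constructor.
- by exists (Passport (nseq m 6) (nseq (3 * m) 2) (nseq (2 * m) 3)); first constructor.
Qed.

Lemma in_genus1_families_same m P P' : same_up_to_permutation P P' ->
  in_genus1_families m P = in_genus1_families m P'.
Proof.
by move=> E; rewrite /in_genus1_families /same_up_to_permutation !(permPl E).
Qed.

(** This solves 1/a + 1/b + 1/c = 1 with [a] the smallest valency; [m] is [r], the number of parts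
    of the largest one. *)
Lemma genus1_solutions n a b c p q r : 0 < n ->
  [/\ n = p * a, n = q * b, n = r * c & n = p + q + r]%N -> r <= q <= p ->
  exists2 m, 0 < m & [\/ [/\ p = 2 * m, q = m, r = m & [/\ a = 2, b = 4 & c = 4]],
    [/\ p = m, q = m, r = m & [/\ a = 3, b = 3 & c = 3]] |
    [/\ p = 3 * m, q = 2 * m, r = m & [/\ a = 2, b = 3 & c = 6]]]%N.
Proof.
move=> n0 [pa qb rc npqr] /andP[rq qp]; have r0 : 0 < r by case: r rc {npqr rq} n0 => // ->.
exists r => //.
have cancel k d e : 0 < k -> (k * d = k * e)%N -> d = e.
  by move=> k0 /eqP; rewrite eqn_pmul2l // => /eqP.
(* [p * a = p + q + r] is at most [3 * p]. *)
have a3 : a <= 3 by rewrite -(leq_pmul2l (leq_trans r0 (leq_trans rq qp))); lia.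
case: a a3 pa => [|[|[|[|a]]]] // _ pa; try lia.
  (* Now [a = 2], so [p = q + r] and [q * b = 2 * (q + r)] is at most [4 * q]. *)
  have b4 : b <= 4 by rewrite -(leq_pmul2l (leq_trans r0 rq)); lia.
  case: b b4 qb => [|[|[|[|[|b]]]]] // _ qb; try lia.
    have -> : c = 6 by apply: (cancel r); lia.
    by apply: Or33; split; try lia.
  have -> : c = 4 by apply: (cancel r); lia.
  by apply: Or31; split; try lia.
have -> : c = 3 by apply: (cancel r); lia.
have -> : b = 3 by apply: (cancel q); lia.
by apply: Or32; split; try lia.
Qed.

Lemma genus1_standardP P : (exists n, genus1_uniform n P) <->
  exists2 m, 0 < m & in_genus1_families m P.
Proof.
split=> [[n] | [m m0 /in_genus1_familiesP[P' S E]]]; last first.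
  case: S E => E; [exists (4 * m)%N | exists (3 * m)%N | exists (6 * m)%N];
    apply: (genus1_uniform_same E); apply/genus1_uniformP; split; try lia.
  - by exists 4, 2, 4, m, (2 * m)%N, m; split=> //; split; lia.
  - by exists 3, 3, 3, m, m, m; split=> //; split; lia.
  - by exists 6, 2, 3, m, (3 * m)%N, (2 * m)%N; split=> //; split; lia.
case/genus1_uniformP=> n0 [a [b [c [p [q [r [-> [pa qb rc npqr]]]]]]]].
have sorted_case a1 b1 c1 p1 q1 r1 :
    [/\ n = p1 * a1, n = q1 * b1, n = r1 * c1 & n = p1 + q1 + r1]%N ->
    r1 <= q1 <= p1 -> exists2 m, 0 < m &
      in_genus1_families m (Passport (nseq p1 a1) (nseq q1 b1) (nseq r1 c1)).
  move=> E /(genus1_solutions n0 E)[m m0 S]; exists m => //.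
  rewrite /in_genus1_families /same_up_to_permutation /entries /=.
  case: S => -[-> -> -> [-> -> ->]]; rewrite ?perm_refl ?orbT //.
  apply/or3P/Or33; rewrite perm_sym.
  by rewrite -[X in perm_eq X _]/([:: _] ++ [:: _] ++ [:: _]) perm_catCA perm_refl.
pose Q P := exists2 m, 0 < m & in_genus1_families m P.
have rot A B C : Q (Passport A B C) -> Q (Passport B C A).
  case=> m m0 E; exists m => //.
  rewrite (in_genus1_families_same _ (P' := Passport A B C)) //.
  by rewrite /same_up_to_permutation -[entries _]/([:: B; C] ++ [:: A]) perm_catC.
have swap A B C : Q (Passport A B C) -> Q (Passport B A C).
  case=> m m0 E; exists m => //.
  rewrite (in_genus1_families_same _ (P' := Passport A B C)) //.
  rewrite /same_up_to_permutation -[entries _]/([:: B] ++ [:: A] ++ [:: C]).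
  by rewrite perm_catCA.
(* Each ordering of [p], [q], [r] is brought to the decreasing one; two of the eight cases are
   cyclic and contradictory. *)
rewrite -/(Q _); case: (leqP p q) => pq; case: (leqP q r) => qr; case: (leqP p r) => pr.
- by apply/rot/rot/swap/sorted_case; [split; lia | lia].
- lia.
- by apply/rot/rot/sorted_case; [split; lia | lia].
- by apply/swap/sorted_case; [split; lia | lia].
- by apply/rot/sorted_case; [split; lia | lia].
- by apply/rot/swap/sorted_case; [split; lia | lia].
- lia.
- by apply: sorted_case; [split; lia | lia].
Qed.

(** * The criterion [m >= 2] and its form in terms of the entry [n^1] *)

Lemma admits_non_regular m P : 0 < m -> in_genus1_families m P ->
  admits P non_regular <-> 2 <= m.
Proof.
move=> m0 /in_genus1_familiesP[P' S E].
apply: (iff_trans (admits_same_up_to_permutation E)); split=> [|m1].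
  rewrite leqNgt ltnS => -[D [DP nr]]; apply/negP=> m1; apply: nr.
  have {m0 m1} mE : m = 1%N by lia.
  rewrite mE in S; case: S DP {E}.
  - exact: regular_4_22_4.
  - exact: regular_3_3_3.
  - exact: regular_6_222_33.
by case: S; [exact: admits_4_2_4 | exact: admits_3_3_3 | exact: admits_6_2_3].
Qed.

(** Every entry has [m], [2 * m] or [3 * m] parts, so a single part requires [m = 1]; then the first
    standard entry is [[:: n]], as its sum is [n]. *)
Lemma trivial_entry n m P : genus1_uniform n P -> 0 < m ->
  in_genus1_families m P -> ([:: n] \in entries P) = (m == 1%N).
Proof.
move=> U m0 /in_genus1_familiesP[P' S E]; rewrite (perm_mem E).
have nE : sumn (lambda0 P') = n.
  have [/andP[_ /and3P[/and3P[_ _ /eqP->]]]] // : genus1_uniform n P'.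
  by apply: genus1_uniform_same U; rewrite same_up_to_permutation_sym.
have [m1 | m1] := eqVneq m 1%N; first by case: S nE => /= <-; rewrite m1.
apply/negbTE; case: S {nE} => /=; rewrite !inE !negb_or;
  apply/and3P; split; apply: contra m1 => /eqP/(congr1 size);
  rewrite size_nseq /=; lia.
Qed.

Theorem proposition5p1 :
  (forall (n : nat) (P : passport),
     is_passport n P -> uniform n P -> genus n P = 1%R ->
     (admits P (fun D => ~ regular D) <-> [:: n] \notin entries P))
  /\
  (forall P : passport,
     (exists n : nat, [/\ is_passport n P, uniform n P & genus n P = 1%R])
     <-> (exists m : nat, (0 < m)%N /\ in_genus1_families m P))
  /\
  (forall (m : nat) (P : passport),
     (0 < m)%N -> in_genus1_families m P ->
     (admits P (fun D => ~ regular D) <-> (2 <= m)%N)).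
Proof.
split; [|split; last exact: admits_non_regular] => [n P pP uP gP | P].
  have U : genus1_uniform n P by [].
  have [m m0 F] := (genus1_standardP P).1 (ex_intro _ n U).
  apply: (iff_trans (admits_non_regular m0 F)).
  by rewrite (trivial_entry U m0 F) ltn_neqAle eq_sym m0 andbT.
apply: (iff_trans (genus1_standardP P)).
by split=> [[m m0 F] | [m [m0 F]]]; exists m.
Qed.
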